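(* Let $X$ and $Y$ be diffeological spaces. The map $Graph:C^{\infty}(X,\mathfrak{P}_{u}(Y))\rightarrow \mathrm{Rel}^{\infty}(X,Y)$, $f\mapsto Graph(f)=\{(x,y)\in X\times Y\mid y\in f(x)\}$, is smooth, where $C^{\infty}(X,\mathfrak{P}_{u}(Y))$ carries the functional diffeology. In other words, the functional diffeology on $C^{\infty}(X,\mathfrak{P}_{u}(Y))$ is finer than (i.e. contained in) the subspace diffeology on it inherited from the union power space $\mathfrak{P}_{u}(X\times Y)$ (through the identification $f\leftrightarrow Graph(f)$).
   Context: A parametrization in a set $X$ is a map $P:U\to X$ with $U$ an open subset of some $\mathbb{R}^n$. A diffeology on $X$ is a set of parametrizations in $X$ (called plots) that contains all constant parametrizations, is local, and is stable under precomposition with smooth maps between open subsets of Euclidean spaces. A map $f$ between diffeological spaces is smooth if $f\circ P$ is a plot for every plot $P$. A subset is D-open if its preimage under every plot is open. Subsets carry the subset diffeology and products the product diffeology. $C^\infty(X,Z)$ is the set of smooth maps; in the functional diffeology, $Q:V\to C^\infty(X,Z)$ is a plot iff for every plot $P:U\to X$ the map $V\times U\to Z$, $(r,s)\mapsto Q(r)(P(s))$, is a plot of $Z$. $\mathfrak{P}(Z)$ is the set of all subsets of $Z$. Union power set diffeology: $P:U\to\mathfrak{P}(Z)$ is a plot of $\mathfrak{P}_u(Z)$ iff there is a family of parametrizations $P_i:U_i\to\mathfrak{P}(Z)$ ($i\in J$, $U_i$ open in the same Euclidean space, $U=\bigcup_i U_i$), each either constant with value $\emptyset$ or of the form $r\mapsto\{p_i(r)\}$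 for a plot $p_i:U_i\to Z$, such that $P(r)=\bigcup\{P_i(r)\mid i\in J,\ r\in U_i\}$ for all $r\in U$. Equivalently: for every $r_0\in U$ and $z_0\in P(r_0)$ there exist an open neighborhood $V\subset U$ of $r_0$ and a plot $\sigma:V\to Z$ with $\sigma(r)\in P(r)$ for all $r\in V$ and $\sigma(r_0)=z_0$. A smooth map $f:A\to B$ is a submersion if for each $a_0\in A$ there is a smooth map $\sigma:O\to A$ on a D-open $O\subset B$ containing $f(a_0)$ with $\sigma(f(a_0))=a_0$ and $f\circ\sigma=\mathrm{id}_O$. A smooth map $f:A\to B$ is a diffeological submersion if for every plot $P:U\to B$ the pullback $P^*f:\{(r,a)\in U\times A\mid P(r)=f(a)\}\to U$, $(r,a)\mapsto r$, is a submersion. A relation $R\subset X\times Y$ (with the subset diffeology) is smooth (with respect to the union power set diffeology) if $\mathrm{Pr}_1:R\to X$ is a diffeological submersion. $\mathrm{Rel}^\infty(X,Y)$ is the set of such smooth (partially defined) relations, with the subset diffeology of $\mathfrak{P}_u(X\times Y)$. *)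

(* Defs.v *)
From HB Require Import structures.
From mathcomp Require Import all_boot all_order all_algebra.
From mathcomp Require Import all_classical all_reals.
From mathcomp Require Import topology normedtype landau derive.
Import Order.TTheory GRing.Theory Num.Theory.
Import numFieldNormedType.Exports.

Set Implicit Arguments.
Unset Strict Implicit.
Unset Printing Implicit Defensive.

Local Open Scope classical_set_scope.
Local Open Scope ring_scope.

(** [Ck k U f]: [f] is of class C^k at the points of [U].  Only used with [U]
    open.  For k > 0 the total differential of [f] exists on [U], and it is of
    class C^(k-1) iff the directional derivatives ['D_v f] are, for all [v]. *)
Fixpoint Ck (R : realType) (n : nat) (W : normedModType R) (k : nat)
    (U : set 'rV[R]_n) (f : 'rV[R]_n -> W) : Prop :=
  match k with
  | 0 => forall x, U x -> {for x, continuous f}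
  | k'.+1 => (forall x, U x -> differentiable f x) /\
             (forall v, Ck k' U ('D_v f))
  end.

Definition Cinfty (R : realType) (n : nat) (W : normedModType R)
  (U : set 'rV[R]_n) (f : 'rV[R]_n -> W) : Prop := forall k, Ck k U f.

Lemma near_eq_differentiable (R : realType) (V W : normedModType R)
    (f g : V -> W) (x : V) :
  {near x, f =1 g} -> differentiable f x -> differentiable g x.
Proof.
move=> fg df.
suff dh : differentiable (g - f) x.
  by have := differentiableD df dh; rewrite addrC subrK.
set h := g - f.
have h0 : \forall y \near x, h y = 0.
  by near=> y; rewrite /h !fctE (near fg y) ?subrr//.
have hx0 : h x = 0 := nbhs_singleton h0.
have expand : h \o shift x = cst (h x) + (\0 : V -> W) +o_ 0 id.
  apply/eqaddoP => e e0 /=.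
  have : \forall y \near 0, h (y + x) = 0.
    by move: h0; rewrite (near_shift 0) subr0.
  apply: filterS => y hy; rewrite !fctE /= hy hx0 !(addr0,subr0) normr0.
  by rewrite mulr_ge0// ltW.
have d0 : 'd h x = \0 :> (V -> W).
  by apply: diff_unique expand => y; exact: cst_continuous.
apply/diff_locallyP; rewrite d0; split=> //.
by move=> y; exact: cst_continuous.
Unshelve. all: by end_near.
Qed.

Section Ck_theory.
Variables (R : realType) (m : nat).
Implicit Types (U : set 'rV[R]_m) (W : normedModType R).

Lemma eq_Ck W k U (f g : 'rV[R]_m -> W) : open U ->
  (forall x, U x -> f x = g x) -> Ck k U f -> Ck k U g.
Proof.
move=> oU; elim: k => [|k IH] in f g *.
  move=> fg cf x Ux; have nfg : {near x, f =1 g}.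
    by apply: filterS (open_nbhs_nbhs (conj oU Ux)) => y /fg.
  rewrite /prop_for /continuous_at -(fg _ Ux).
  exact: (cvg_trans (near_eq_cvg nfg) (cf _ Ux)).
move=> fg [df Df]; split=> [x Ux|v].
  apply: near_eq_differentiable (df x Ux).
  by apply: filterS (open_nbhs_nbhs (conj oU Ux)) => y /fg.
apply: IH (Df v) => x Ux; apply: near_eq_derive.
by apply: filterS (open_nbhs_nbhs (conj oU Ux)) => y /fg.
Qed.

Lemma Ck_sub W k U V (f : 'rV[R]_m -> W) : V `<=` U -> Ck k U f -> Ck k V f.
Proof.
move=> VU; elim: k => [|k IH] in f *; first by move=> cf x /VU /cf.
by move=> [df Df]; split=> [x /VU|v]; [exact: df | exact/IH/Df].
Qed.

Lemma Ck_local W k U (f : 'rV[R]_m -> W) :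
  (forall x, U x -> exists2 V, V x & Ck k V f) -> Ck k U f.
Proof.
elim: k => [|k IH] in f *.
  by move=> H x /H[V Vx]; exact.
move=> H; split=> [x /H[V Vx [df _]]|v]; first exact: df.
by apply: IH => x /H[V Vx [_ Df]]; exists V => //; exact: Df.
Qed.

Lemma CkW W k U (f : 'rV[R]_m -> W) : Ck k.+1 U f -> Ck k U f.
Proof.
elim: k => [|k IH] in f *.
  by move=> [df _] x Ux; exact/differentiable_continuous/df.
by move=> [df Df]; split=> // v; exact/IH/Df.
Qed.

Lemma Ck_cst W k U (c : W) : Ck k U (cst c).
Proof.
elim: k c => [|k IH] c; first by move=> x _; exact: cst_continuous.
split=> [x _|v]; first exact: differentiable_cst.
rewrite [X in Ck _ _ X](_ : _ = cst 0); first exact: IH.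
by apply/funext => x; rewrite derive_cst.
Qed.

Lemma CkD W k U (f g : 'rV[R]_m -> W) : open U ->
  Ck k U f -> Ck k U g -> Ck k U (f + g).
Proof.
move=> oU; elim: k => [|k IH] in f g *.
  by move=> cf cg x Ux; apply: continuousD; [exact: cf|exact: cg].
move=> [df Df] [dg Dg]; split=> [x Ux|v].
  by apply: differentiableD; [exact: df|exact: dg].
apply: eq_Ck (IH _ _ (Df v) (Dg v)) => // x Ux.
by rewrite deriveD//; apply: diff_derivable; [exact: df|exact: dg].
Qed.

Lemma Ck_sum W k U n (f : 'I_n -> 'rV[R]_m -> W) : open U ->
  (forall i, Ck k U (f i)) -> Ck k U (\sum_i f i).
Proof.
move=> oU cf; elim/big_ind: _ => [|g h|i _]; first exact: Ck_cst.
  exact: CkD.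
exact: cf.
Qed.

Lemma CkM k U (f g : 'rV[R]_m -> R) : open U ->
  Ck k U f -> Ck k U g -> Ck k U (f * g).
Proof.
move=> oU; elim: k => [|k IH] in f g *.
  by move=> cf cg x Ux; apply: continuousM; [exact: cf|exact: cg].
move=> Cf Cg; have := (Cf, Cg) => -[[df Df] [dg Dg]]; split=> [x Ux|v].
  by apply: differentiableM; [exact: df|exact: dg].
apply: (@eq_Ck _ _ _ (f * 'D_v g + g * 'D_v f)) => // [x Ux|].
  by rewrite deriveM//; apply: diff_derivable; [exact: df|exact: dg].
by apply: CkD => //; apply: IH; by [exact: CkW Cf|exact: CkW Cg|exact: Df|exact: Dg].
Qed.

Lemma Ck_linear W W' k U (L : {linear W -> W'}) (f : 'rV[R]_m -> W) : open U ->
  continuous L -> Ck k U f -> Ck k U (L \o f).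
Proof.
move=> oU cL; elim: k => [|k IH] in f *.
  by move=> cf x Ux; apply: continuous_comp; [exact: cf|exact: cL].
move=> [df Df]; split=> [x Ux|v].
  apply: differentiable_comp; first exact: df.
  exact: linear_differentiable.
apply: eq_Ck (IH _ (Df v)) => // x Ux.
have dfx := df x Ux; have dL := linear_differentiable (f x) cL.
rewrite (deriveE _ (differentiable_comp dfx dL)) diff_comp// diff_lin//=.
by rewrite deriveE.
Qed.

Lemma Ck_coord k U n (f : 'rV[R]_m -> 'rV[R]_n) j : open U ->
  Ck k U f -> Ck k U (fun x => f x 0 j : R).
Proof.
move=> oU; have Llin : linear (fun u : 'rV[R]_n => u 0 j : R).
  by move=> a u v; rewrite !mxE.
pose LM := GRing.isLinear.Build _ _ _ _ _ Llin.
pose L : {linear 'rV[R]_n -> R} := HB.pack (fun u : 'rV[R]_n => u 0 j : R) LM.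
by apply: (@Ck_linear _ _ _ _ L) => //; exact: coord_continuous.
Qed.

Lemma coord_Ck k U n (f : 'rV[R]_m -> 'rV[R]_n) : open U ->
  (forall j, Ck k U (fun x => f x 0 j : R)) -> Ck k U f.
Proof.
move=> oU cf.
pose e j : 'rV[R]_n := delta_mx 0 j.
rewrite (_ : f = \sum_j (fun x => f x 0 j *: e j)); last first.
  by apply/funext => x; rewrite fct_sumE -row_sum_delta.
apply: Ck_sum => // j.
have Llin : linear (fun a : R => a *: e j).
  by move=> a u v; rewrite scalerDl scalerA.
pose LM := GRing.isLinear.Build _ _ _ _ _ Llin.
pose L : {linear R -> 'rV[R]_n} := HB.pack (fun a : R => a *: e j) LM.
apply: (@Ck_linear _ _ _ _ L (fun x => f x 0 j : R)) => //.
exact: scalel_continuous.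
Qed.

Lemma Ck_comp_scalar k U n (V : set 'rV[R]_n) (f : 'rV[R]_m -> 'rV[R]_n)
    (g : 'rV[R]_n -> R) : open U -> (forall x, U x -> V (f x)) ->
  Ck k U f -> Ck k V g -> Ck k U (g \o f).
Proof.
move=> oU fUV; elim: k => [|k IH] in g *.
  by move=> cf cg x Ux; apply: continuous_comp; [exact: cf|exact/cg/fUV].
move=> Cf [dg Dg]; have := Cf => -[df Df]; split=> [x Ux|v].
  by apply: differentiable_comp; [exact: df|exact/dg/fUV].
pose e j : 'rV[R]_n := delta_mx 0 j.
apply: (@eq_Ck _ _ _ (\sum_j (fun x => 'D_v f x 0 j : R) * ('D_(e j) g \o f)))
    => // [x Ux|].
  have [dfx dgx] := (df x Ux, dg _ (fUV _ Ux)).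
  rewrite (deriveE _ (differentiable_comp dfx dgx)) diff_comp//=.
  rewrite -(deriveE v dfx) [in RHS](row_sum_delta ('D_v f x)) linear_sum.
  rewrite fct_sumE.
  by apply: eq_bigr => j _; rewrite linearZ/= -deriveE.
apply: Ck_sum => // j; apply: CkM => //; first by apply: Ck_coord => //; exact: Df.
by apply: IH; [exact: CkW Cf|exact: Dg].
Qed.

End Ck_theory.

Lemma Cinfty_id (R : realType) (m : nat) (U : set 'rV[R]_m) :
  open U -> Cinfty U (id : 'rV[R]_m -> 'rV[R]_m).
Proof.
move=> oU; case=> [|k]; first by move=> x _ A.
split=> [x _|v]; first exact: (@ex_diff _ _ _ _ _ id id).
apply: (@eq_Ck _ _ _ k U (cst v)) => // [x _|]; last exact: Ck_cst.
by rewrite derive_id.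
Qed.

Lemma Cinfty_comp (R : realType) (m n p : nat) (U : set 'rV[R]_m)
    (V : set 'rV[R]_n) (f : 'rV[R]_m -> 'rV[R]_n) (g : 'rV[R]_n -> 'rV[R]_p) :
  open U -> open V -> (forall x, U x -> V (f x)) ->
  Cinfty U f -> Cinfty V g -> Cinfty U (g \o f).
Proof.
move=> oU oV fUV Cf Cg k; apply: coord_Ck => // j.
have := Ck_comp_scalar oU fUV (Cf k) (Ck_coord j oV (Cg k)).
exact.
Qed.


(** A function defined only on [U] is smooth iff it has a total extension that
    is smooth at the points of [U]; as [U] is open in all uses, the values of the
    extension outside of [U] play no role. *)
Definition smooth_param (R : realType) (m n : nat) (U : set 'rV[R]_m)
    (F : U -> 'rV[R]_n) : Prop :=
  exists2 f : 'rV[R]_m -> 'rV[R]_n, Cinfty U f & forall u : U, F u = f (val u).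

(** Parametrizations are functions on the subtype associated with an open set
    of R^n = ['rV_n]; the case n = 0 is included.  Restriction of plots to
    smaller open sets is an instance of [is_plot_comp]. *)
Record diffeology (R : realType) (X : Type) := Diffeology {
  is_plot : forall (n : nat) (U : set 'rV[R]_n), (U -> X) -> Prop;
  is_plot_open : forall n (U : set 'rV[R]_n) (P : U -> X),
    is_plot P -> open U;
  is_plot_cst : forall n (U : set 'rV[R]_n) (x : X),
    open U -> is_plot (fun _ : U => x);
  is_plot_local : forall n (U : set 'rV[R]_n) (P : U -> X), open U ->
    (forall u : U, exists (V : set 'rV[R]_n) (VU : V `<=` U),
      [/\ open V, V (val u) & is_plot (P \o subfun VU)]) ->
    is_plot P;
  is_plot_comp : forall m n (U : set 'rV[R]_m) (V : set 'rV[R]_n)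
      (P : V -> X) (F : U -> V),
    open U -> smooth_param (val \o F) -> is_plot P -> is_plot (P \o F)
}.

Definition finer (R : realType) (X : Type) (D1 D2 : diffeology R X) : Prop :=
  forall n (U : set 'rV[R]_n) (P : U -> X), is_plot D1 P -> is_plot D2 P.

Structure diffSpace (R : realType) := DiffSpace {
  diff_carrier :> Type;
  diffeology_of : diffeology R diff_carrier
}.

Definition plot (R : realType) (X : diffSpace R) (n : nat) (U : set 'rV[R]_n)
  (P : U -> X) : Prop := is_plot (diffeology_of X) P.

Definition smooth (R : realType) (A B : diffSpace R) (f : A -> B) : Prop :=
  forall n (U : set 'rV[R]_n) (P : U -> A), plot P -> plot (f \o P).

Definition D_open (R : realType) (X : diffSpace R) (O : set X) : Prop :=
  forall n (U : set 'rV[R]_n) (P : U -> X),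
    plot P -> open (val @` (P @^-1` O)).

Lemma smooth_param_preimage (R : realType) m n (U : set 'rV[R]_m)
    (F : U -> 'rV[R]_n) (V : set 'rV[R]_n) : open U -> open V ->
  smooth_param F -> open (val @` (F @^-1` V)).
Proof.
move=> oU oV [f Cf Ff].
rewrite openE => _ [u /= FVu <-].
have Uu : U (val u) := set_mem (valP u).
have nV : \forall x \near val u, V (f x).
  by apply: (Cf 0%N _ Uu); apply: open_nbhs_nbhs; split=> //; rewrite -Ff.
apply: filterS2 nV (open_nbhs_nbhs (conj oU Uu)) => x Vfx Ux.
by exists (SigSub (mem_set Ux)) => //=; rewrite /preimage/= Ff.
Qed.

Lemma smooth_param_local (R : realType) m n (U : set 'rV[R]_m)
    (F : U -> 'rV[R]_n) :
  (forall u : U, exists (V : set 'rV[R]_m) (VU : V `<=` U),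
      [/\ open V, V (val u) & smooth_param (F \o subfun VU)]) ->
  smooth_param F.
Proof.
move=> H.
pose f x := if pselect (x \in U) is left Ux then F (SigSub Ux) else 0.
have Ff u : F u = f (val u).
  rewrite /f; case: pselect => [Ux|]; last by case; exact: valP.
  by congr F; exact: val_inj.
exists f => // k; apply: Ck_local => x Ux.
have [V [VU [oV Vx [g Cg Fg]]]] := H (SigSub (mem_set Ux)).
exists V => //; apply: eq_Ck (Cg k) => // y Vy.
have := Fg (SigSub (mem_set Vy)).
by move=> /= <-; rewrite Ff.
Qed.

Lemma smooth_param_cst (R : realType) m n (U : set 'rV[R]_m)
  (x : 'rV[R]_n) : smooth_param (fun _ : U => x).
Proof. by exists (cst x) => // k; exact: Ck_cst. Qed.

Lemma smooth_param_comp (R : realType) m n p (U : set 'rV[R]_m)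
    (V : set 'rV[R]_n) (F : U -> V) (G : V -> 'rV[R]_p) : open U -> open V ->
  smooth_param (val \o F) -> smooth_param G -> smooth_param (G \o F).
Proof.
move=> oU oV [f Cf Ff] [g Cg Gg]; exists (g \o f); last first.
  by move=> u; rewrite /= Gg -Ff.
apply: Cinfty_comp oU oV _ Cf Cg => x Ux.
have := Ff (SigSub (mem_set Ux)) => /= <-; exact: set_mem (valP _).
Qed.

Lemma smooth_param_linear (R : realType) m n (U : set 'rV[R]_m)
    (L : {linear 'rV[R]_m -> 'rV[R]_n}) : open U -> continuous L ->
  smooth_param (fun u : U => L (val u)).
Proof.
move=> oU cL; exists L => // k.
apply: (@Ck_linear _ _ _ _ k U L id) => //; exact: Cinfty_id.
Qed.

Lemma smooth_param_subfun (R : realType) m (U V : set 'rV[R]_m)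
  (UV : U `<=` V) : open U -> smooth_param (val \o subfun UV).
Proof.
move=> oU.
by apply: (@smooth_param_linear _ _ _ U (idfun : {linear _ -> _})) => // x.
Qed.

Section euclidean_space.
Variables (R : realType) (n : nat).

Definition euclidean_plot m (U : set 'rV[R]_m) (P : U -> 'rV[R]_n) :=
  open U /\ smooth_param P.

Lemma euclidean_plot_open m (U : set 'rV[R]_m) (P : U -> 'rV[R]_n) : euclidean_plot P -> open U.
Proof. by case. Qed.

Lemma euclidean_plot_cst m (U : set 'rV[R]_m) (x : 'rV[R]_n) :
  open U -> euclidean_plot (fun _ : U => x).
Proof. by split=> //; exact: smooth_param_cst. Qed.

Lemma euclidean_plot_local m (U : set 'rV[R]_m) (P : U -> 'rV[R]_n) : open U ->
    (forall u : U, exists (V : set 'rV[R]_m) (VU : V `<=` U),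
      [/\ open V, V (val u) & euclidean_plot (P \o subfun VU)]) ->
    euclidean_plot P.
Proof.
move=> oU H; split=> //; apply: smooth_param_local => u.
by have [V [VU [oV Vu [_ sP]]]] := H u; exists V, VU.
Qed.

Lemma euclidean_plot_comp m p (U : set 'rV[R]_m) (V : set 'rV[R]_p)
      (P : V -> 'rV[R]_n) (F : U -> V) :
    open U -> smooth_param (val \o F) -> euclidean_plot P -> euclidean_plot (P \o F).
Proof.
by move=> oU sF [oV sP]; split=> //; exact: smooth_param_comp.
Qed.

Definition euclidean_space : diffSpace R :=
  DiffSpace (Diffeology euclidean_plot_open euclidean_plot_cst euclidean_plot_local euclidean_plot_comp).

End euclidean_space.

Section pullback_diffeology.
Variables (R : realType) (X : Type) (B : diffSpace R) (f : X -> B).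

Definition pullback_plot n (U : set 'rV[R]_n) (P : U -> X) := plot (f \o P).

Lemma pullback_plot_open n (U : set 'rV[R]_n) (P : U -> X) : pullback_plot P -> open U.
Proof. exact: is_plot_open. Qed.

Lemma pullback_plot_cst n (U : set 'rV[R]_n) (x : X) :
  open U -> pullback_plot (fun _ : U => x).
Proof. exact: is_plot_cst. Qed.

Lemma pullback_plot_local n (U : set 'rV[R]_n) (P : U -> X) : open U ->
    (forall u : U, exists (V : set 'rV[R]_n) (VU : V `<=` U),
      [/\ open V, V (val u) & pullback_plot (P \o subfun VU)]) ->
    pullback_plot P.
Proof. exact: is_plot_local. Qed.

Lemma pullback_plot_comp m n (U : set 'rV[R]_m) (V : set 'rV[R]_n)
      (P : V -> X) (F : U -> V) :
    open U -> smooth_param (val \o F) -> pullback_plot P -> pullback_plot (P \o F).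
Proof. exact: is_plot_comp. Qed.

Definition pullback_diffeology : diffeology R X :=
  Diffeology pullback_plot_open pullback_plot_cst pullback_plot_local pullback_plot_comp.

End pullback_diffeology.

Definition sub_space (R : realType) (X : diffSpace R) (S : set X) :
  diffSpace R := DiffSpace (pullback_diffeology (val : S -> X)).

Section prod_space.
Variables (R : realType) (A B : diffSpace R).

Definition prod_plot n (U : set 'rV[R]_n) (P : U -> A * B) :=
  plot (fst \o P) /\ plot (snd \o P).

Lemma prod_plot_open n (U : set 'rV[R]_n) (P : U -> A * B) : prod_plot P -> open U.
Proof. by case=> + _; exact: is_plot_open. Qed.

Lemma prod_plot_cst n (U : set 'rV[R]_n) (x : A * B) :
  open U -> prod_plot (fun _ : U => x).
Proof. by move=> oU; split; exact: is_plot_cst. Qed.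

Lemma prod_plot_local n (U : set 'rV[R]_n) (P : U -> A * B) : open U ->
    (forall u : U, exists (V : set 'rV[R]_n) (VU : V `<=` U),
      [/\ open V, V (val u) & prod_plot (P \o subfun VU)]) ->
    prod_plot P.
Proof.
move=> oU H; split; apply: is_plot_local => // u;
  by have [V [VU [oV Vu []]]] := H u; exists V, VU.
Qed.

Lemma prod_plot_comp m n (U : set 'rV[R]_m) (V : set 'rV[R]_n)
      (P : V -> A * B) (F : U -> V) :
    open U -> smooth_param (val \o F) -> prod_plot P -> prod_plot (P \o F).
Proof.
move=> oU sF [p1 p2].
by split; [exact: (is_plot_comp oU sF p1)|exact: (is_plot_comp oU sF p2)].
Qed.

Definition prod_space : diffSpace R :=
  DiffSpace (Diffeology prod_plot_open prod_plot_cst prod_plot_local prod_plot_comp).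

End prod_space.

(** The product V x U, as a subset of R^(m + n). *)
Definition prod_domain (R : realType) (m n : nat) (V : set 'rV[R]_m)
    (U : set 'rV[R]_n) : set 'rV[R]_(m + n) :=
  [set x | V (lsubmx x) /\ U (rsubmx x)].

Definition prod_fst (R : realType) (m n : nat) (V : set 'rV[R]_m)
    (U : set 'rV[R]_n) (w : prod_domain V U) : V :=
  SigSub (mem_set (set_mem (valP w)).1).

Definition prod_snd (R : realType) (m n : nat) (V : set 'rV[R]_m)
    (U : set 'rV[R]_n) (w : prod_domain V U) : U :=
  SigSub (mem_set (set_mem (valP w)).2).

Lemma open_prod_domain (R : realType) (m n : nat) (V : set 'rV[R]_m)
    (U : set 'rV[R]_n) : open V -> open U -> open (prod_domain V U).
Proof.
move=> oV oU; apply: (@openI _ (lsubmx @^-1` V) (rsubmx @^-1` U)).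
  by apply: open_comp => // x _; exact: continuous_lsubmx.
by apply: open_comp => // x _; exact: continuous_rsubmx.
Qed.

Lemma smooth_prod_snd (R : realType) (m n : nat) (V : set 'rV[R]_m)
    (U : set 'rV[R]_n) : open V -> open U ->
  smooth_param (val \o @prod_snd R m n V U).
Proof.
move=> oV oU; apply: (@smooth_param_linear R (m + n) n _ rsubmx).
  exact: open_prod_domain.
exact: continuous_rsubmx.
Qed.

Definition prod_map_fst (R : realType) (m m' n : nat) (V : set 'rV[R]_m)
    (V' : set 'rV[R]_m') (U : set 'rV[R]_n) (F : V' -> V)
    (w : prod_domain V' U) : prod_domain V U.
Proof.
exists (row_mx (val (F (prod_fst w))) (val (prod_snd w))).
apply/mem_set; rewrite /prod_domain/= row_mxKl row_mxKr.
split; first exact: (set_mem (valP (F (prod_fst w)))).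
exact: (set_mem (valP (prod_snd w))).
Defined.

Lemma smooth_prod_map_fst (R : realType) (m m' n : nat) (V : set 'rV[R]_m)
    (V' : set 'rV[R]_m') (U : set 'rV[R]_n) (F : V' -> V) :
  open V' -> open U -> smooth_param (val \o F) ->
  smooth_param (val \o @prod_map_fst R m m' n V V' U F).
Proof.
move=> oV' oU [f Cf Ff].
have oW := open_prod_domain oV' oU.
exists (fun x => row_mx (f (lsubmx x)) (rsubmx x)); last first.
  by move=> w /=; congr row_mx; exact: (Ff (prod_fst w)).
have Cl : Cinfty (prod_domain V' U) (f \o lsubmx).
  apply: (Cinfty_comp oW oV' _ _ Cf) => [x []//|k].
  apply: (@Ck_linear _ _ _ _ k _ lsubmx id) => //.
    exact: continuous_lsubmx.
  exact: Cinfty_id.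
have Cr : Cinfty (prod_domain V' U) rsubmx.
  move=> k; apply: (@Ck_linear _ _ _ _ k _ rsubmx id) => //.
    exact: continuous_rsubmx.
  exact: Cinfty_id.
move=> k; apply: coord_Ck => // j.
case: (split_ordP j) => i ->.
  apply: (eq_Ck oW _ (Ck_coord i oW (Cl k))) => x _.
  by rewrite row_mxEl.
apply: (eq_Ck oW _ (Ck_coord i oW (Cr k))) => x _.
by rewrite row_mxEr.
Qed.

(** Functional diffeology on the set of smooth maps from [X] to [Z]. *)
Section fun_space.
Variables (R : realType) (X Z : diffSpace R).

Local Notation C := [set f : X -> Z | smooth f].

Definition fun_plot m (V : set 'rV[R]_m) (Q : V -> C) :=
  open V /\ forall n (U : set 'rV[R]_n) (P : U -> X), plot P ->
    plot (fun w : prod_domain V U => val (Q (prod_fst w)) (P (prod_snd w))).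

Lemma fun_plot_open n (V : set 'rV[R]_n) (Q : V -> C) : fun_plot Q -> open V.
Proof. by case. Qed.

Lemma fun_plot_cst n (V : set 'rV[R]_n) (f : C) :
  open V -> fun_plot (fun _ : V => f).
Proof.
move=> oV; split=> // p U P pP; have oU := is_plot_open pP.
have := is_plot_comp (open_prod_domain oV oU) (smooth_prod_snd oV oU)
  (set_mem (valP f) _ _ _ pP).
exact.
Qed.

Lemma fun_plot_local n (V : set 'rV[R]_n) (Q : V -> C) : open V ->
    (forall v : V, exists (W : set 'rV[R]_n) (WV : W `<=` V),
      [/\ open W, W (val v) & fun_plot (Q \o subfun WV)]) ->
    fun_plot Q.
Proof.
move=> oV H; split=> // p U P pP; have oU := is_plot_open pP.
apply: is_plot_local (open_prod_domain oV oU) _ => w.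
have [W [WV [oW Ww [_ pQ]]]] := H (prod_fst w).
have sub : prod_domain W U `<=` prod_domain V U.
  by move=> x [Wx Ux]; split=> //; exact: (WV _ Wx).
exists (prod_domain W U), sub; split; first exact: open_prod_domain.
  by split=> //; exact: (set_mem (valP w)).2.
have := pQ _ _ _ pP; congr is_plot; apply/funext => x /=.
by congr (val (Q _) (P _)); exact: val_inj.
Qed.

Lemma fun_plot_comp m n (V' : set 'rV[R]_m) (V : set 'rV[R]_n)
      (Q : V -> C) (F : V' -> V) :
    open V' -> smooth_param (val \o F) -> fun_plot Q -> fun_plot (Q \o F).
Proof.
move=> oV' sF [oV pQ]; split=> // p U P pP; have oU := is_plot_open pP.
have := is_plot_comp (open_prod_domain oV' oU)
  (smooth_prod_map_fst oV' oU sF) (pQ _ _ _ pP).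
congr is_plot; apply/funext => x /=.
by congr (val (Q _) (P _)); apply: val_inj; rewrite /= ?row_mxKl ?row_mxKr.
Qed.

Definition fun_space : diffSpace R :=
  DiffSpace (Diffeology fun_plot_open fun_plot_cst fun_plot_local fun_plot_comp).

End fun_space.

(** Union power set diffeology on the set of all subsets of [Z]. *)
Section upow_space.
Variables (R : realType) (Z : diffSpace R).

Definition upow_plot n (U : set 'rV[R]_n) (P : U -> set Z) : Prop :=
  open U /\
  exists (J : Type) (D : J -> set 'rV[R]_n) (p : forall i, D i -> set Z),
    [/\ forall i, open (D i),
        U = \bigcup_i D i,
        forall i, p i = (fun=> set0) \/
          exists2 q : D i -> Z, plot q & p i = (fun r => [set q r]) &
        forall r : U, P r =
          [set z | exists (i : J) (s : D i), val s = val r /\ p i s z]].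

Lemma upow_plotP n (U : set 'rV[R]_n) (P : U -> set Z) :
  upow_plot P <->
  open U /\ forall (r0 : U) (z0 : Z), P r0 z0 ->
    exists (V : set 'rV[R]_n) (VU : V `<=` U) (sigma : V -> Z),
      [/\ open V, plot sigma, forall r, P (subfun VU r) (sigma r) &
          exists2 s0 : V, val s0 = val r0 & sigma s0 = z0].
Proof.
split=> [[oU [J [D [p [oD UD pD PE]]]]]|[oU H]]; split=> //.
  move=> r0 z0; rewrite PE => -[i [s [sr0 psz]]].
  have DU : D i `<=` U by rewrite UD => x Dx; exists i.
  have [pi0|[q pq piq]] := pD i; first by rewrite pi0 in psz.
  exists (D i), DU, q; split=> //.
    by move=> r; rewrite PE; exists i, r; rewrite piq.
  by exists s => //; rewrite piq in psz.
pose K := {rz : U * Z | P rz.1 rz.2}.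
have [V0 V0P] : {V0 : K -> set 'rV[R]_n & forall i, exists (VU : V0 i `<=` U)
    (sigma : V0 i -> Z),
      [/\ open (V0 i), plot sigma, forall r, P (subfun VU r) (sigma r) &
          exists2 s0 : V0 i, val s0 = val (sval i).1 & sigma s0 = (sval i).2]}.
  have /choice[V0 V0P] : forall i : K, exists V0, exists (VU : V0 `<=` U)
    (sigma : V0 -> Z),
      [/\ open V0, plot sigma, forall r, P (subfun VU r) (sigma r) &
          exists2 s0 : V0, val s0 = val (sval i).1 & sigma s0 = (sval i).2].
    by move=> [[r z] Prz]; exact: H.
  by exists V0.
have VU i : V0 i `<=` U by have [] := V0P i.
have {}V0P i : {sigma : V0 i -> Z | [/\ open (V0 i), plot sigma,
    forall r, P (subfun (@VU i) r) (sigma r) &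
    exists2 s0 : V0 i, val s0 = val (sval i).1 & sigma s0 = (sval i).2]}.
  apply: cid; have [VU' [sigma [? ? PV ?]]] := V0P i; exists sigma; split=> //.
  by move=> r; rewrite (_ : subfun _ r = subfun VU' r)//; exact: val_inj.
exists (option K), (fun i => if i is Some k then V0 k else U),
  (fun i => match i return ((if i is Some k then V0 k else U) -> set Z) with
            | Some k => fun r => [set sval (V0P k) r]
            | None => fun=> set0 end); split.
- by case=> [k|//]; have [] := svalP (V0P k).
- apply/seteqP; split=> [x Ux|x [[k|] _]]; first by exists None.
    exact: (@VU k).
  by [].
- case=> [k|]; last by left.
  by right; exists (sval (V0P k)) => //; have [] := svalP (V0P k).
move=> r; apply/seteqP; split=> z.
  move=> Prz; pose k : K := exist _ (r, z) Prz.
  exists (Some k); have [_ _ _ [s0 s0r s0z]] := svalP (V0P k).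
  by exists s0; split=> //=; rewrite s0z.
move=> [[k|] [s [sr]]]//=.
have [_ _ PV _] := svalP (V0P k) => ->.
by have := PV s; rewrite (_ : subfun _ s = r)//; exact: val_inj.
Qed.

Lemma upow_plot_open n (U : set 'rV[R]_n) (P : U -> set Z) : upow_plot P -> open U.
Proof. by case. Qed.

Lemma upow_plot_cst n (U : set 'rV[R]_n) (A : set Z) :
  open U -> upow_plot (fun _ : U => A).
Proof.
move=> oU; apply/upow_plotP; split=> // r0 z0 Az0.
exists U, (fun x => id), (fun=> z0); split=> //; first exact: is_plot_cst.
by exists r0.
Qed.

Lemma upow_plot_local n (U : set 'rV[R]_n) (P : U -> set Z) : open U ->
    (forall u : U, exists (V : set 'rV[R]_n) (VU : V `<=` U),
      [/\ open V, V (val u) & upow_plot (P \o subfun VU)]) ->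
    upow_plot P.
Proof.
move=> oU H; apply/upow_plotP; split=> // r0 z0 Prz.
have [V [VU [oV Vr /upow_plotP[_ PV]]]] := H r0.
have [|W [WV [sigma [oW ps PW [s0 s0r s0z]]]]] := PV (SigSub (mem_set Vr)) z0.
  by rewrite /= (_ : subfun _ _ = r0)//; exact: val_inj.
exists W, (subset_trans WV VU), sigma; split=> //; last by exists s0.
move=> r; rewrite (_ : subfun _ r = subfun VU (subfun WV r)); first exact: PW.
exact: val_inj.
Qed.

Lemma upow_plot_comp m n (U : set 'rV[R]_m) (V : set 'rV[R]_n)
      (P : V -> set Z) (F : U -> V) :
    open U -> smooth_param (val \o F) -> upow_plot P -> upow_plot (P \o F).
Proof.
move=> oU sF /upow_plotP[oV H]; apply/upow_plotP; split=> // r0 z0 PF.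
have [W [WV [sigma [oW ps PW [s0 s0r s0z]]]]] := H _ _ PF.
pose U' : set 'rV[R]_m := val @` ((val \o F) @^-1` W).
have oU' : open U' by exact: smooth_param_preimage.
have UU : U' `<=` U by move=> _ [u _ <-]; exact: set_mem (valP u).
have WF (u : U') : W (val (F (subfun UU u))).
  case: u => x /[dup] /set_mem[u Wu <-] xU'.
  by rewrite (_ : subfun _ _ = u)//; exact: val_inj.
pose G (u : U') : W := SigSub (mem_set (WF u)).
exists U', UU, (sigma \o G); split=> //.
- apply: is_plot_comp ps => //.
  exact: smooth_param_comp (smooth_param_subfun UU oU') sF.
- move=> r; have := PW (G r).
  by rewrite (_ : subfun _ (G r) = F (subfun UU r))//; exact: val_inj.
have Ur0 : U' (val r0).
  by exists r0 => //; rewrite /preimage/= -s0r; exact: set_mem (valP s0).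
exists (SigSub (mem_set Ur0)) => //=; rewrite -s0z; congr sigma.
by apply: val_inj; rewrite /= s0r; congr (val (F _)); exact: val_inj.
Qed.

Definition upow_space : diffSpace R :=
  DiffSpace (Diffeology upow_plot_open upow_plot_cst upow_plot_local upow_plot_comp).

End upow_space.

Definition submersion (R : realType) (A B : diffSpace R) (f : A -> B) : Prop :=
  smooth f /\
  forall a0 : A, exists O : set B, [/\ D_open O, O (f a0) &
    exists sigma : sub_space O -> A,
      [/\ smooth sigma,
          forall o : O, val o = f a0 -> sigma o = a0 &
          forall o : O, f (sigma o) = val o]].

Definition domain_space (R : realType) (n : nat) (U : set 'rV[R]_n) :
  diffSpace R := @sub_space R (euclidean_space R n) U.

(** The total space of the pullback P^*f, inside U x A. *)
Definition fiber_product (R : realType) (A B : diffSpace R) (f : A -> B)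
    (n : nat) (U : set 'rV[R]_n) (P : U -> B) :
    set (prod_space (domain_space U) A) :=
  [set ra | P ra.1 = f ra.2].

Definition plot_pullback (R : realType) (A B : diffSpace R) (f : A -> B)
    (n : nat) (U : set 'rV[R]_n) (P : U -> B) :
    sub_space (fiber_product f P) -> domain_space U :=
  fun w => (val w).1.

Definition diff_submersion (R : realType) (A B : diffSpace R) (f : A -> B) :
    Prop :=
  smooth f /\ forall n (U : set 'rV[R]_n) (P : U -> B),
    plot P -> submersion (@plot_pullback R A B f n U P).

Definition rel_fst (R : realType) (X Y : diffSpace R)
    (r : set (prod_space X Y)) : sub_space r -> X := fun w => (val w).1.

Definition smooth_relation (R : realType) (X Y : diffSpace R)
  (r : set (prod_space X Y)) : Prop := diff_submersion (@rel_fst R X Y r).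

Definition rel_space (R : realType) (X Y : diffSpace R) : diffSpace R :=
  @sub_space R (upow_space (prod_space X Y))
    [set r : set (prod_space X Y) | smooth_relation r].

(** Since [graph_of] is injective ([graph_of_inj]), its domain may be identified
    with its range, and [pullback_diffeology graph_of] is then the subspace
    diffeology that the domain inherits from the union power space of X x Y. *)
Definition graph_of (R : realType) (X Y : diffSpace R)
    (f : fun_space X (upow_space Y)) : upow_space (prod_space X Y) :=
  [set xy : X * Y | val f xy.1 xy.2].

Lemma graph_of_inj (R : realType) (X Y : diffSpace R) :
  injective (@graph_of R X Y).
Proof.
move=> f g fg; apply: val_inj; apply/funext => x; apply/seteqP.
split=> y fxy.
  by have : graph_of g (x, y) by rewrite -fg.
by have : graph_of f (x, y) by rewrite fg.
Qed.

(* Main.v *)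
(** A smooth map [f] into the union power space has local smooth selections
    through every point of its values.  Along a plot [P] of X, a selection
    [sigma] of [f \o P] gives the local section [u |-> (u, (P u, sigma u))] of
    the pullback of the first projection of the graph, so that the graph is a
    smooth relation.  If [Q] is a plot of smooth maps, then freezing the point
    [x0] leaves the plot [r |-> Q r x0] of the union power space of Y, and a
    selection [sigma] of it gives the selection [r |-> (x0, sigma r)] of the
    graphs. *)
Require Import Defs.
From mathcomp Require Import all_boot all_order all_algebra.
From mathcomp Require Import all_classical all_reals.
From mathcomp Require Import topology normedtype.
Import numFieldNormedType.Exports.

Set Implicit Arguments.
Unset Strict Implicit.
Unset Printing Implicit Defensive.

Local Open Scope classical_set_scope.
Local Open Scope ring_scope.

Lemma D_open_domain (R : realType) (n : nat) (U V : set 'rV[R]_n) :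
  open V -> D_open (X := domain_space U) [set u : U | V (val u)].
Proof.
by move=> oV m W Q [oW sQ]; exact: (smooth_param_preimage oW oV sQ).
Qed.

Lemma rel_fst_smooth (R : realType) (X Y : diffSpace R)
    (r : set (prod_space X Y)) : smooth (@rel_fst R X Y r).
Proof. by move=> n U P []. Qed.

Lemma plot_pullback_smooth (R : realType) (A B : diffSpace R) (f : A -> B)
    (n : nat) (U : set 'rV[R]_n) (P : U -> B) :
  smooth (@plot_pullback R A B f n U P).
Proof. by move=> m W Q []. Qed.

Lemma smooth_relation_graph (R : realType) (X Y : diffSpace R)
    (f : fun_space X (upow_space Y)) : smooth_relation (graph_of f).
Proof.
split; first exact: rel_fst_smooth.
move=> n U P pP; split; first exact: plot_pullback_smooth.
move=> a0; case Ea0: (val a0) => [u0 xy0].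
have Pu0 : P u0 = (val xy0).1.
  by have := set_mem (valP a0); rewrite Ea0.
have fu0 : val f (P u0) (val xy0).2.
  by rewrite Pu0; exact: (set_mem (valP xy0)).
have pfP : upow_plot (val f \o P) by exact: (set_mem (valP f)).
have /upow_plotP[oU H] := pfP.
have [V [VU [sigma [oV ps fs [s0 s0u s0y]]]]] := H u0 _ fu0.
pose O : set (domain_space U) := [set u : U | V (val u)].
have OV (o : sub_space O) : V (val (val o)) := set_mem (valP o).
pose v (o : sub_space O) : V := SigSub (mem_set (OV o)).
have subv o : subfun VU (v o) = val o by exact: val_inj.
have gr (o : sub_space O) : graph_of f (P (val o), sigma (v o)).
  by have := fs (v o); rewrite subv.
pose g (o : sub_space O) : sub_space (graph_of f) := SigSub (mem_set (gr o)).
(* The fibre condition reduces to [P (val o) = P (val o)], hence [erefl]. *)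
pose s (o : sub_space O) : sub_space (fiber_product (@rel_fst R X Y _) P) :=
  @SigSub _ _ _ (val o, g o) (mem_set (erefl (P (val o)))).
exists O; split; first exact: D_open_domain.
  by rewrite /O /plot_pullback/= Ea0/= -s0u; exact: set_mem (valP s0).
exists s; split=> //.
- move=> m W Q pQ; have [oW sQ] := pQ.
  split; first exact: pQ.
  split; first exact: (is_plot_comp oW sQ pP).
  exact: (is_plot_comp (F := v \o Q) oW sQ ps).
(* The section passes through [a0]: over [u0] the point [v o] is [s0], where [sigma] takes the
   Y-coordinate of [a0]. *)
move=> o; rewrite /plot_pullback Ea0/= => ou0.
apply: val_inj; rewrite Ea0/= ou0; congr pair; apply: val_inj => /=.
rewrite ou0 Pu0 (_ : v o = s0) ?s0y; last by apply: val_inj; rewrite /= ou0.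
by rewrite -surjective_pairing.
Qed.

(** For [n = 0] this identifies [V] with V x R^0, as evaluation at a point requires. *)
Lemma smooth_param_row_mx0 (R : realType) (m n : nat) (V : set 'rV[R]_m) :
  open V -> smooth_param (fun r : V => row_mx (val r) (0 : 'rV[R]_n)).
Proof.
move=> oV; exists (fun r => row_mx r 0) => // k; apply: coord_Ck => // j.
case: (split_ordP j) => i ->.
  apply: (eq_Ck oV _ (Ck_coord i oV (Cinfty_id oV k))) => x _.
  by rewrite row_mxEl.
by apply: (eq_Ck oV _ (Ck_cst k V 0)) => x _; rewrite row_mxEr mxE.
Qed.

(** The point [x] is a plot on R^0; testing [Q] against it gives a plot on V x R^0, which is pulled
    back to [V] along [r |-> (r, 0)]. *)
Lemma eval_smooth (R : realType) (X Z : diffSpace R) (x : X) :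
  smooth (fun f : fun_space X Z => val f x : Z).
Proof.
move=> n V Q [oV /(_ 0 setT (fun=> x)) pQ].
have {}pQ := pQ (is_plot_cst _ x openT).
have W r : prod_domain V [set: 'rV[R]_0] (row_mx r 0) <-> V r.
  by rewrite /prod_domain/= row_mxKl; split=> [[]|].
pose j (r : V) : prod_domain V [set: 'rV[R]_0] :=
  SigSub (mem_set ((W _).2 (set_mem (valP r)))).
have := is_plot_comp (F := j) oV (smooth_param_row_mx0 _ oV) pQ.
congr is_plot; apply/funext => r /=; congr (val (Q _) _).
by apply: val_inj; rewrite /= row_mxKl.
Qed.

Lemma graph_of_smooth (R : realType) (X Y : diffSpace R) :
  smooth (@graph_of R X Y).
Proof.
move=> n V Q pQ; have oV := is_plot_open pQ.
apply/upow_plotP; split=> // r0 [x0 y0] Qr0.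
have /upow_plotP[_ H] := eval_smooth x0 pQ.
have [W [WV [sigma [oW ps Qs [s0 s0r s0y]]]]] := H r0 y0 Qr0.
exists W, WV, (fun r => (x0, sigma r)); split=> //.
  by split=> //; exact: is_plot_cst.
by exists s0; rewrite // s0y.
Qed.

Theorem proposition3p26 (R : realType) (X Y : diffSpace R) :
  (exists Graph : fun_space X (upow_space Y) -> rel_space X Y,
      (forall f, val (Graph f) = graph_of f) /\ smooth Graph) /\
  finer (diffeology_of (fun_space X (upow_space Y)))
        (pullback_diffeology (@graph_of R X Y)).
Proof.
(* Plots of a pullback diffeology are tested after composition, so both claims unfold to smoothness
   of [graph_of]. *)
split; last exact: graph_of_smooth.
exists (fun f => SigSub (mem_set (smooth_relation_graph f))); split=> //.
exact: graph_of_smooth.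
Qed.
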